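(* Let $\mu_0,\nu_0\in\mathcal P_c^*(\mathbb R^2)$ satisfy $\mathcal N_{\mathrm m}[\mu_0]\neq\mathcal N_{\mathrm m}[\nu_0]$, and consider the classes $$\mathbb F=\{(\mathbf A\cdot+\mathbf y)_\#\mu_0 : \mathbf A\in\mathrm{GL}(2),\ \mathbf y\in\mathbb R^2\},\qquad \mathbb G=\{(\mathbf A\cdot+\mathbf y)_\#\nu_0 : \mathbf A\in\mathrm{GL}(2),\ \mathbf y\in\mathbb R^2\}.$$ Then $\mathbb F\subset\mathcal P_c^*(\mathbb R^2)$ and $\mathbb G\subset\mathcal P_c^*(\mathbb R^2)$, and $\mathbb F$ and $\mathbb G$ are linearly separable in max-normalized R-CDT space, i.e. the sets $\mathcal N_{\mathrm m}[\mathbb F]$ and $\mathcal N_{\mathrm m}[\mathbb G]$ are linearly separable in $L^\infty_\rho(\mathbb R)$.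
   Context: Let $\mathbb S_1=\{x\in\mathbb R^2:\|x\|=1\}$. For $\theta\in\mathbb S_1$ let $S_\theta(x)=\langle x,\theta\rangle$ and, for a finite Borel measure $\mu$ on $\mathbb R^2$, let $\mathcal R_\theta[\mu]=(S_\theta)_\#\mu$ (pushforward measure on $\mathbb R$). Fix a reference Borel probability measure $\rho$ on $\mathbb R$ that has no atoms. For a probability measure $\nu$ on $\mathbb R$ with distribution function $F_\nu(t)=\nu((-\infty,t])$, set $F_\nu^{[-1]}(t)=\inf\{s\in\mathbb R: F_\nu(s)>t\}$ and define its cumulative distribution transform (CDT) $\hat\nu=F_\nu^{[-1]}\circ F_\rho$. Write $\widehat{\mathcal R}_\theta[\mu]$ for the CDT of $\mathcal R_\theta[\mu]$. For $g\in L^2_\rho(\mathbb R)$ let $\operatorname{mean}(g)=\int_{\mathbb R}g\,\mathrm d\rho$ and $\operatorname{std}(g)=\big(\int_{\mathbb R}|g-\operatorname{mean}(g)|^2\,\mathrm d\rho\big)^{1/2}$. Let $\mathcal P_c^*(\mathbb R^2)$ denote the set of Borel probability measures on $\mathbb R^2$ with compact support such that the affine hull of the support has dimension $>1$ (the support is not contained in a line). For $\mu\in\mathcal P_c^*(\mathbb R^2)$, $\theta\in\mathbb S_1$, $t\in\mathbb R$, the normalized R-CDT is $\mathcal N_\theta[\mu](t)=\big(\widehat{\mathcal R}_\theta[\mu](t)-\operatorname{mean}(\widehat{\mathcal R}_\theta[\mu])\big)/\operatorname{std}(\widehat{\mathcal R}_\theta[\mu])$, and the max-normalized R-CDT is $\mathcal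 N_{\mathrm m}[\mu](t)=\sup_{\theta\in\mathbb S_1}\mathcal N_\theta[\mu](t)$. Two subsets $A,B$ of a normed space $V$ are linearly separable if there exist a continuous linear functional $\ell$ on $V$ and $c\in\mathbb R$ with $\ell(a)>c$ for all $a\in A$ and $\ell(b)<c$ for all $b\in B$. *)

(* Defs.v *)
From HB Require Import structures.
From mathcomp Require Import all_boot all_order all_algebra.
From mathcomp Require Import all_classical all_reals all_analysis.
Set Implicit Arguments.
Unset Strict Implicit.
Unset Printing Implicit Defensive.
Import Order.TTheory GRing.Theory Num.Theory.
Import numFieldNormedType.Exports.
Local Open Scope classical_set_scope.
Local Open Scope ring_scope.

Section RCDT.
Context {R : realType}.

(* R^2 is modelled as R * R (product Borel sigma-algebra, product topology). *)
Definition dotp (x th : R * R) : R := x.1 * th.1 + x.2 * th.2.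

Definition S1 : set (R * R) := [set th | th.1 ^+ 2 + th.2 ^+ 2 = 1].

Definition Rtheta (mu : {measure set (R * R) -> \bar R}) (th : R * R)
  : set R -> \bar R := pushforward mu (fun x => dotp x th).

Definition cdf (nu : set R -> \bar R) (t : R) : R := fine (nu [set` `]-oo, t]]).

Definition ginv (F : R -> R) (t : R) : R := inf [set s | t < F s].

Definition CDT (rho : {measure set R -> \bar R}) (nu : set R -> \bar R) : R -> R :=
  fun t => ginv (cdf nu) (cdf rho t).

Definition mean (rho : {measure set R -> \bar R}) (g : R -> R) : R :=
  fine (\int[rho]_x (g x)%:E)%E.

Definition std (rho : {measure set R -> \bar R}) (g : R -> R) : R :=
  Num.sqrt (fine (\int[rho]_x ((`|g x - mean rho g| ^+ 2)%:E))%E).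

Definition Ntheta (rho : {measure set R -> \bar R})
  (mu : {measure set (R * R) -> \bar R}) (th : R * R) (t : R) : R :=
  let g := CDT rho (Rtheta mu th) in (g t - mean rho g) / std rho g.

Definition Nm (rho : {measure set R -> \bar R})
  (mu : {measure set (R * R) -> \bar R}) (t : R) : R :=
  sup [set Ntheta rho mu th t | th in S1].

Definition supp (mu : {measure set (R * R) -> \bar R}) : set (R * R) :=
  [set x | forall r : R, 0 < r -> (0 < mu (ball x r))%E].

Definition Pcstar (mu : {measure set (R * R) -> \bar R}) : Prop :=
  [/\ mu setT = 1%E, compact (supp mu) &
      ~ (exists a b c : R, (a, b) != (0, 0) /\
           supp mu `<=` [set x | a * x.1 + b * x.2 = c])].

Definition affine (A : 'M[R]_2) (y : R * R) (x : R * R) : R * R :=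
  (A ord0 ord0 * x.1 + A ord0 ord_max * x.2 + y.1,
   A ord_max ord0 * x.1 + A ord_max ord_max * x.2 + y.2).

Definition affine_class (mu0 : {measure set (R * R) -> \bar R})
  : set {measure set (R * R) -> \bar R} :=
  [set nu | exists (A : 'M[R]_2) (y : R * R),
      \det A != 0 /\ (nu : set (R * R) -> \bar R) = pushforward mu0 (affine A y)].

Definition Linf (rho : {measure set R -> \bar R}) (f : R -> R) : Prop :=
  measurable_fun setT f /\ finite_norm rho +oo%E f.

Definition cont_lin_functional (rho : {measure set R -> \bar R})
  (l : (R -> R) -> R) : Prop :=
  (forall (a : R) f g, Linf rho f -> Linf rho g ->
      l (fun t => a * f t + g t) = a * l f + l g) /\
  (exists C : R, forall f, Linf rho f ->
      `|l f| <= C * fine ('N[rho]_(+oo%E)[EFin \o f])%E).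

Definition lin_separable (rho : {measure set R -> \bar R})
  (A B : set (R -> R)) : Prop :=
  exists (l : (R -> R) -> R) (c : R), cont_lin_functional rho l /\
    (forall f, A f -> c < l f) /\ (forall g, B g -> l g < c).

End RCDT.

(* Main.v *)
Require Import Defs.
From HB Require Import structures.
From mathcomp Require Import all_boot all_order all_algebra.
From mathcomp Require Import all_classical all_reals all_analysis.
From mathcomp Require Import measurable_realfun ess_sup_inf ring lra.
Import Order.TTheory GRing.Theory Num.Theory.
Import numFieldNormedType.Exports.
Local Open Scope classical_set_scope.
Local Open Scope ring_scope.

(* The affine invariance of the max-normalized R-CDT reduces each class to one
   point: with A^T theta = k theta', the projection of (A . + y)_# mu along theta is the
   image of that of mu along theta' under z |-> k z + <y, theta>; the CDT inherits
   this affine relation, and normalization cancels it. As theta |-> theta' permutes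
   the circle, the suprema agree, so N_m[F] = {f} and N_m[G] = {g} rho-almost
   everywhere, and l(u) = \int (f - g) u drho separates them since
   l(f) - l(g) = \int (f - g)^2 drho > 0.
   That N_m is essentially bounded rests on a uniform lower bound of the standard
   deviations: rho having no atoms, the CDT pushes rho to the projected measure,
   so these are the values on the circle of the covariance form of mu, which is
   positive definite because mu is not carried by a line. Measurability is free: on
   {F_rho < 1} every normalized R-CDT is nondecreasing, hence so is the supremum. *)

(** * Distribution functions *)

(** Continuity from below, in the form that turns bounds on half-lines into limit properties of
    distribution functions. *)
Lemma measure_bigcup_le d (T : measurableType d) (R : realType)
    (mu : {measure set T -> \bar R}) (F : (set T)^nat) (c : \bar R) :
  (forall n, measurable (F n)) -> {homo F : n m / (n <= m)%N >-> n `<=` m} ->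
  (forall n, (mu (F n) <= c)%E) -> (mu (\bigcup_n F n) <= c)%E.
Proof.
move=> mF ndF muF.
have Fcvg : (mu \o F) n @[n --> \oo] --> mu (\bigcup_n F n).
  apply: nondecreasing_cvg_mu => //; first exact: bigcup_measurable.
  by move=> n m nm; apply/subsetPset; exact: ndF.
rewrite -(cvg_lim _ Fcvg)//; apply: lime_le; first exact: cvgP Fcvg.
by near=> n; exact: muF.
Unshelve. all: by end_near. Qed.

Section distribution_function.
Context {R : realType}.
Implicit Types (P : probability R R) (s t u : R).

Lemma EFin_cdf P t : (Defs.cdf P t)%:E = P `]-oo, t]%classic.
Proof. by rewrite /Defs.cdf fineK// fin_num_measure. Qed.

Lemma EFin_ccdf P t : (1 - Defs.cdf P t)%:E = P `]t, +oo[%classic.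
Proof.
by rewrite -setCitvl probability_setC// EFinB EFin_cdf.
Qed.

Lemma dcdf_ge0 P t : 0 <= Defs.cdf P t.
Proof. by rewrite /Defs.cdf fine_ge0. Qed.

Lemma dcdf_le1 P t : Defs.cdf P t <= 1.
Proof. by rewrite -lee_fin EFin_cdf probability_le1. Qed.

Lemma dcdf_nd P : {homo Defs.cdf P : s t / s <= t}.
Proof.
by move=> s t st; rewrite -lee_fin !EFin_cdf le_measure ?inE//; exact: subitvPr.
Qed.

Lemma cdf_ubound_ge1 P u : (forall t, Defs.cdf P t <= u) -> 1 <= u.
Proof.
move=> Pu; rewrite -lee_fin -(@probability_setT _ _ _ P).
have <- : \bigcup_n `]-oo, n%:R]%classic = [set: R].
  rewrite -subTset => t _; exists (Num.truncn t).+1 => //=.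
  by rewrite in_itv/= ltW// Num.Theory.truncnS_gt.
apply: measure_bigcup_le => // [n m nm|n]; last by rewrite /= -EFin_cdf lee_fin.
by apply: subitvPr; rewrite bnd_simp ler_nat.
Qed.

Lemma cdf_lbound_le0 P u : (forall t, u <= Defs.cdf P t) -> u <= 0.
Proof.
move=> Pu; suff : 1 <= 1 - u by lra.
rewrite -lee_fin -(@probability_setT _ _ _ P).
have <- : \bigcup_n `](- n%:R), +oo[%classic = [set: R].
  rewrite -subTset => t _; exists (Num.truncn (- t)).+1 => //=.
  by rewrite in_itv/= andbT ltrNl Num.Theory.truncnS_gt.
apply: measure_bigcup_le => // [n m nm|n]; last first.
  by rewrite /= -EFin_ccdf lee_fin lerB.
by apply: subitvPl; rewrite bnd_simp lerN2 ler_nat.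
Qed.

(** Right continuity: []s, +oo[] is the increasing union of the half-lines []s + 1/(n+1), +oo[],
    each of mass at most [1 - u]. *)
Lemma cdf_right_limit P u s : (forall t, s < t -> u <= Defs.cdf P t) ->
  u <= Defs.cdf P s.
Proof.
move=> Pu; suff : 1 - Defs.cdf P s <= 1 - u by lra.
rewrite -lee_fin EFin_ccdf.
have -> : `]s, +oo[%classic = \bigcup_n `](s + n.+1%:R^-1), +oo[%classic.
  apply/seteqP; split=> t /=; rewrite in_itv/= andbT.
    move=> /ltr_add_invr[k skt]; exists k => //=.
    by rewrite in_itv/= andbT.
  by case=> n _ /=; rewrite in_itv/= andbT; apply: lt_trans; rewrite ltrDl.
apply: measure_bigcup_le => // [n m nm|n]; last first.
  by rewrite /= -EFin_ccdf lee_fin lerB// Pu// ltrDl.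
by apply: subitvPl; rewrite bnd_simp lerD2l lef_pV2 ?posrE// ler_nat.
Qed.

(** Left continuity at a point that is not an atom: once the null singleton is split off, []-oo, s[]
    is exhausted by closed half-lines ending before [s]. *)
Lemma cdf_left_limit P u s : P [set s] = 0%E ->
  (forall t, t < s -> Defs.cdf P t <= u) -> Defs.cdf P s <= u.
Proof.
move=> Ps0 Pu; rewrite -lee_fin EFin_cdf.
have -> : `]-oo, s]%classic = `]-oo, s[%classic `|` [set s].
  apply/seteqP; split=> t /=; rewrite !in_itv/=.
    by rewrite le_eqVlt => /orP[/eqP|]; [right|left].
  by case=> [/ltW//|->].
apply: le_trans (measureU2 _ _ _) _ => //.
rewrite [X in (_ + X)%E]Ps0 adde0.
have -> : `]-oo, s[%classic = \bigcup_n `]-oo, (s - n.+1%:R^-1)]%classic.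
  apply/seteqP; split=> t /=; rewrite in_itv/=.
    move=> /ltr_add_invr[k skt]; exists k => //=.
    by rewrite in_itv/= lerBrDr ltW.
  by case=> n _ /=; rewrite in_itv/= => /le_lt_trans; apply; rewrite ltrBlDr ltrDl.
apply: measure_bigcup_le => // [n m nm|n]; last first.
  by rewrite /= -EFin_cdf lee_fin Pu// ltrBlDr ltrDl.
by apply: subitvPr; rewrite bnd_simp lerB// lef_pV2 ?posrE// ler_nat.
Qed.

Lemma measurable_dcdf P : measurable_fun setT (Defs.cdf P).
Proof. by apply: nondecreasing_measurable => //; exact: dcdf_nd. Qed.

Lemma measurable_cdf_le P u : measurable [set t | Defs.cdf P t <= u].
Proof.
rewrite -[X in measurable X]setTI.
have -> : [set t | Defs.cdf P t <= u] = Defs.cdf P @^-1` `]-oo, u].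
  by apply/seteqP; split => t /=; rewrite in_itv.
exact: measurable_dcdf.
Qed.

Lemma measurable_cdf_ge P u : measurable [set t | u <= Defs.cdf P t].
Proof.
rewrite -[X in measurable X]setTI.
have -> : [set t | u <= Defs.cdf P t] = Defs.cdf P @^-1` `[u, +oo[.
  by apply/seteqP; split => t /=; rewrite in_itv/= andbT.
exact: measurable_dcdf.
Qed.

(** With [atomless_cdf_ge], this says that the distribution function of an atomless law is uniformly
    distributed under that law. The sublevel set lies in the half-line ending at its supremum, where
    left continuity still gives a value at most [u]. *)
Lemma atomless_cdf_le P u : (forall x, P [set x] = 0%E) -> 0 <= u ->
  (P [set t | (Defs.cdf P t <= u)%R] <= u%:E)%E.
Proof.
move=> P0 u0; set E := [set t | _].
have [[t0 Et0]|/set0P/negP/negPn/eqP ->] := pselect (E !=set0); last first.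
  by rewrite measure0 lee_fin.
(* If the sublevel set is unbounded, monotonicity keeps the distribution function below [u]
   everywhere, which forces [1 <= u]. *)
have [ubE|nubE] := pselect (has_ubound E); last first.
  apply: le_trans (probability_le1 _ (measurable_cdf_le _ _)) _.
  rewrite lee_fin; apply: (@cdf_ubound_ge1 P) => t.
  rewrite leNgt; apply/negP => ut; apply: nubE; exists t => s Es.
  rewrite leNgt; apply/negP => /ltW /(dcdf_nd P) => ts.
  by move: Es; rewrite /E/= leNgt (lt_le_trans ut ts).
apply: (@le_trans _ _ (P `]-oo, sup E]%classic)).
  apply: le_measure; rewrite ?inE//; first exact: measurable_cdf_le.
  by move=> t Et /=; rewrite in_itv/=; exact: ub_le_sup.
rewrite -EFin_cdf lee_fin; apply: cdf_left_limit => // t tE.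
have [s Es ts] : exists2 s, E s & t < s by apply: sup_gt => //; exists t0.
by apply: le_trans (dcdf_nd P _ _ (ltW ts)) _.
Qed.

Lemma atomless_cdf_ge P u : (forall x, P [set x] = 0%E) -> u <= 1 ->
  (P [set t | (u <= Defs.cdf P t)%R] <= (1 - u)%:E)%E.
Proof.
move=> P0 u1; set E := [set t | _].
have [[t0 Et0]|/set0P/negP/negPn/eqP ->] := pselect (E !=set0); last first.
  by rewrite measure0 lee_fin subr_ge0.
have [lbE|nlbE] := pselect (has_lbound E); last first.
  apply: le_trans (probability_le1 _ (measurable_cdf_ge _ _)) _.
  rewrite lee_fin; suff : u <= 0 by lra.
  apply: (@cdf_lbound_le0 P) => t; rewrite leNgt; apply/negP => ut; apply: nlbE; exists t => s Es.
  rewrite leNgt; apply/negP => /ltW /(dcdf_nd P) => ts.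
  by move: Es; rewrite /E/= leNgt (le_lt_trans ts ut).
apply: (@le_trans _ _ (P ([set inf E] `|` `]inf E, +oo[%classic))).
  apply: le_measure; rewrite ?inE//; first exact: measurable_cdf_ge.
    exact: measurableU.
  move=> t Et /=; rewrite in_itv/= andbT; have := ge_inf lbE Et.
  by rewrite le_eqVlt => /orP[/eqP ->|]; [left|right].
apply: le_trans (measureU2 _ _ _) _ => //.
rewrite [X in (X + _)%E]P0 add0e -[leLHS]/(P `]inf E, +oo[%classic).
rewrite -EFin_ccdf lee_fin lerB//; apply: cdf_right_limit => t Et.
have [s Es st] : exists2 s, E s & s < t by apply: inf_lt => //; exists t0.
by apply: le_trans (dcdf_nd P _ _ (ltW st)).
Qed.

Lemma atomless_cdf_ge1 P : (forall x, P [set x] = 0%E) ->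
  P [set t | 1 <= Defs.cdf P t] = 0%E.
Proof.
move=> P0; apply/eqP; rewrite eq_le measure_ge0 andbT.
by have := atomless_cdf_ge P 1 P0 (lexx _); rewrite subrr.
Qed.

(** Open right half-lines form a pi-system that generates the Borel sets and exhausts the line. *)
Lemma probability_eq_cdf (P Q : probability R R) :
  (forall t, P `]t, +oo[%classic = Q `]t, +oo[%classic) ->
  forall A, measurable A -> P A = Q A.
Proof.
move=> PQ A mA.
apply: (@measure_unique _ _ _ (@RGenOInfty.G R)
  (fun n => `](- n%:R), +oo[%classic)) => //.
- exact: RGenOInfty.measurableE.
- move=> _ _ [s ->] [t ->]; exists (Num.max s t).
  by apply/seteqP; split => x /=; rewrite !in_itv/= !andbT gt_max => /andP.
- by move=> n; exists (- n%:R).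
- rewrite -subTset => t _; exists (Num.truncn (- t)).+1 => //=.
  by rewrite in_itv/= andbT ltrNl Num.Theory.truncnS_gt.
- by move=> _ [t ->]; exact: PQ.
- by move=> n; apply: le_lt_trans (probability_le1 P _) (ltry 1).
Qed.

(** Inside the down-closed set [D], preimages of right half-lines are intervals. *)
Lemma measurable_nondecreasing_in (D : set R) (f : R -> R) :
  measurable D -> (forall s t, D t -> s <= t -> D s) ->
  (forall s t, D t -> s <= t -> f s <= f t) -> measurable_fun D f.
Proof.
move=> mD ddown fnd.
apply: (measurability (@RGenCInfty.G R)) => [|/= _ [_] [r] -> <-].
  exact: RGenCInfty.measurableE.
apply: is_interval_measurable => s t/=.
rewrite !in_itv/= !andbT => -[Ds fs] [Dt ft] u /andP[su ut].
have Du : D u by exact: ddown Dt ut.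
by split => //; rewrite in_itv/= andbT (le_trans fs)// fnd.
Qed.

End distribution_function.

(** * The cumulative distribution transform *)

Section generalized_inverse.
Context {R : realType} (nu : probability R R) (a b : R).
Hypothesis nua : forall s, s < a -> Defs.cdf nu s = 0.
Hypothesis nub : Defs.cdf nu b = 1.
Implicit Types (s u v : R).

Let E u := [set s | u < Defs.cdf nu s].

Let E_lb u s : 0 <= u -> E u s -> a <= s.
Proof.
move=> u0 us; rewrite leNgt; apply/negP => /nua s0.
by move: us; rewrite /E/= s0 ltNge u0.
Qed.

Let E_neq0 u : u < 1 -> E u !=set0.
Proof. by move=> u1; exists b; rewrite /E/= nub. Qed.

(** Together with [ginv_le_cdf], this is the Galois relation between a distribution function and its
    generalized inverse, up to strictness. The bracket [[a, b]] keeps the infimum over a nonempty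
    set bounded below when [0 <= u < 1]. *)
Lemma ginv_le u s : 0 <= u -> u < Defs.cdf nu s -> ginv (Defs.cdf nu) u <= s.
Proof. by move=> u0 us; apply: ge_inf => //; exists a => t; exact: E_lb. Qed.

Lemma ginv_le_cdf u s : u < 1 -> ginv (Defs.cdf nu) u <= s -> u <= Defs.cdf nu s.
Proof.
move=> u1 us; apply: cdf_right_limit => t st.
have [e Ee et] : exists2 e, E u e & e < t.
  by apply: inf_lt; [exact: E_neq0|exact: le_lt_trans us st].
by apply: le_trans (ltW Ee) (dcdf_nd nu _ _ (ltW et)).
Qed.

Lemma ginv_bounds u : 0 <= u -> u < 1 -> a <= ginv (Defs.cdf nu) u <= b.
Proof.
move=> u0 u1; apply/andP; split; last by apply: ginv_le; rewrite ?nub.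
by apply: lb_le_inf; [exact: E_neq0|move=> s; exact: E_lb].
Qed.

Lemma ginv_nd u v : 0 <= u -> u <= v -> v < 1 ->
  ginv (Defs.cdf nu) u <= ginv (Defs.cdf nu) v.
Proof.
move=> u0 uv v1; apply: lb_le_inf; first exact: E_neq0.
by move=> s vs; apply: ginv_le => //; exact: le_lt_trans uv vs.
Qed.

Lemma ginv_ge1 u : 1 <= u -> ginv (Defs.cdf nu) u = 0.
Proof.
move=> u1; rewrite /ginv (_ : [set s | _] = set0) ?inf0//.
rewrite -subset0 => s /=; rewrite ltNge => /negP; apply.
by apply: le_trans u1; exact: dcdf_le1.
Qed.

Context (rho : probability R R).
Hypothesis rho0 : forall x, rho [set x] = 0%E.

Let D := [set t | Defs.cdf rho t < 1].

Lemma cdf_lt1_ge1 : D = ~` [set t | 1 <= Defs.cdf rho t].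
Proof. by apply/seteqP; split => t /=; rewrite /D/= ltNge => /negP. Qed.

Lemma measurable_cdf_lt1 : measurable D.
Proof. by rewrite cdf_lt1_ge1; apply: measurableC; exact: measurable_cdf_ge. Qed.

(* Where [F_rho t = 1] the generalized inverse is the infimum of the empty set, with
   junk value [0]: monotonicity is only available on [D]. *)
Lemma measurable_split_cdf_lt1 (f : R -> R) (c : R) :
  (forall s t, Defs.cdf rho t < 1 -> s <= t -> f s <= f t) ->
  (forall t, 1 <= Defs.cdf rho t -> f t = c) -> measurable_fun setT f.
Proof.
move=> fnd fc; rewrite -(setUv D); apply/measurable_funU => //.
- exact: measurable_cdf_lt1.
- by apply: measurableC; exact: measurable_cdf_lt1.
split.
  apply: measurable_nondecreasing_in => //; first exact: measurable_cdf_lt1.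
  by move=> s t Dt st; exact: le_lt_trans (dcdf_nd rho _ _ st) Dt.
apply: (eq_measurable_fun (cst c)); last exact: measurable_cst.
by move=> t; rewrite inE /D/= => /negP; rewrite -leNgt => /fc.
Qed.

Lemma CDT_nd s t : Defs.cdf rho t < 1 -> s <= t -> CDT rho nu s <= CDT rho nu t.
Proof.
by move=> t1 st; apply: ginv_nd => //; [exact: dcdf_ge0|exact: dcdf_nd].
Qed.

Lemma CDT_bounds t : Defs.cdf rho t < 1 -> a <= CDT rho nu t <= b.
Proof. by move=> t1; apply: ginv_bounds => //; exact: dcdf_ge0. Qed.

Lemma CDT_cdf_ge1 t : 1 <= Defs.cdf rho t -> CDT rho nu t = 0.
Proof. by move=> t1; exact: ginv_ge1. Qed.

Lemma measurable_CDT : measurable_fun setT (CDT rho nu).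
Proof. exact: measurable_split_cdf_lt1 CDT_nd CDT_cdf_ge1. Qed.

(** The quantile transform pushes [rho] to [nu]. By the Galois relation, the event [CDT > s] lies in
    [F_rho >= F_nu s], and its complement in [F_rho <= F_nu s] up to a null set. Uniformity of
    [F_rho] bounds both masses, so the two inequalities meet. *)
Lemma CDT_gt_prob s :
  rho (CDT rho nu @^-1` `]s, +oo[%classic) = nu `]s, +oo[%classic.
Proof.
have mg A : measurable A -> measurable (CDT rho nu @^-1` A).
  by move=> mA; rewrite -[X in measurable X]setTI; exact: measurable_CDT.
rewrite -EFin_ccdf; apply/eqP; rewrite eq_le; apply/andP; split.
  apply: le_trans (atomless_cdf_ge rho _ rho0 (dcdf_le1 nu s)).
  apply: le_measure; rewrite ?inE//; [by apply: mg|exact: measurable_cdf_ge|].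
  move=> t /=; rewrite in_itv/= andbT => st; rewrite leNgt; apply/negP => ts.
  by have := ginv_le _ _ (dcdf_ge0 rho t) ts; rewrite leNgt => /negP; apply.
rewrite -setCitvl preimage_setC (probability_setC rho (mg _ (measurable_itv _))).
rewrite EFinB leeB//.
(* The null set [1 <= F_rho] is added because the CDT takes its junk value there, which may be at
   most [s] whatever [F_nu s] is. *)
have le1 : ((rho [set t | (Defs.cdf rho t <= Defs.cdf nu s)%R] +
   rho [set t | (1 <= Defs.cdf rho t)%R]) <= (Defs.cdf nu s)%:E)%E.
  rewrite [X in (_ + X)%E](atomless_cdf_ge1 _ rho0) adde0.
  apply: atomless_cdf_le rho0 (dcdf_ge0 nu s).
apply: le_trans le1; apply: le_trans (measureU2 _ _ _).
- apply: le_measure; rewrite ?inE.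
  + by apply: mg.
  + by apply: measurableU; [exact: measurable_cdf_le|exact: measurable_cdf_ge].
  + move=> t /=; rewrite in_itv/= => st.
    have [t1|t1] := leP 1 (Defs.cdf rho t); first by right.
    by left; exact: ginv_le_cdf st.
- exact: measurable_cdf_le.
- exact: measurable_cdf_ge.
Qed.

Lemma ge0_integral_CDT (f : R -> \bar R) : measurable_fun setT f ->
  (forall x, (0 <= f x)%E) ->
  (\int[rho]_t f (CDT rho nu t) = \int[nu]_x f x)%E.
Proof.
move=> mf f0.
pose X : {mfun R >-> R} := mfun_Sub (mem_set measurable_CDT).
rewrite -(@ge0_integral_distribution _ _ _ _ _ rho X)//.
apply: eq_measure_integral => A mA _.
apply: (probability_eq_cdf (distribution rho X) nu) => // t.
exact: CDT_gt_prob.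
Qed.

End generalized_inverse.

(** * Essentially bounded functions *)

Section ae_bounded.
Context {d} {T : measurableType d} {R : realType} (P : probability T R).
Implicit Types f g : T -> R.

(** A working form of essential boundedness: stable under sums and products and contained in the
    integrable functions, so it settles the integrability conditions below. *)
Definition ae_bounded f :=
  measurable_fun setT f /\ exists C, {ae P, forall x, `|f x| <= C}.

Lemma ae_bounded_cst c : ae_bounded (fun=> c).
Proof. by split => //; exists `|c|; apply: nearW. Qed.

Lemma ae_boundedD f g : ae_bounded f -> ae_bounded g ->
  ae_bounded (fun x => f x + g x).
Proof.
move=> [mf [C fC]] [mg [C' gC]]; split; first exact: measurable_funD.
exists (C + C'); apply: filterS2 fC gC => x fC gC.
by rewrite (le_trans (ler_normD _ _))// lerD.
Qed.

Lemma ae_boundedM f g : ae_bounded f -> ae_bounded g ->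
  ae_bounded (fun x => f x * g x).
Proof.
move=> [mf [C fC]] [mg [C' gC]]; split; first exact: measurable_funM.
exists (C * C'); apply: filterS2 fC gC => x fC gC.
by rewrite normrM ler_pM.
Qed.

Lemma ae_bounded_integrable f : ae_bounded f -> P.-integrable setT (EFin \o f).
Proof.
move=> [mf [C fC]]; apply/integrableP; split; first exact/measurable_EFinP.
apply: (@le_lt_trans _ _ (\int[P]_x `|C|%:E)%E).
  apply: ae_ge0_le_integral => //.
  - by apply: measurableT_comp => //; exact/measurable_EFinP.
  - apply: filterS fC => x fC _ /=.
    by rewrite lee_fin (le_trans fC)// ler_norm.
by rewrite integral_cst// [X in (_ * X)%E]probability_setT mule1 ltry.
Qed.

Lemma RintegralTD f g : ae_bounded f -> ae_bounded g ->
  (\int[P]_x (f x + g x) = \int[P]_x f x + \int[P]_x g x)%R.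
Proof. by move=> bf bg; rewrite RintegralD//; exact: ae_bounded_integrable. Qed.

Lemma RintegralTZ c f : ae_bounded f ->
  (\int[P]_x (c * f x) = c * \int[P]_x f x)%R.
Proof. by move=> bf; rewrite RintegralZl//; exact: ae_bounded_integrable. Qed.

Lemma RintegralT_cst c : (\int[P]_x c = c)%R.
Proof. by rewrite Rintegral_cst// [X in fine X]probability_setT mulr1. Qed.

Lemma ae_eq_RintegralT f g : measurable_fun setT f -> measurable_fun setT g ->
  {ae P, forall x, f x = g x} -> (\int[P]_x f x = \int[P]_x g x)%R.
Proof.
move=> mf mg fg; congr fine; apply: ae_eq_integral => //.
- exact/measurable_EFinP.
- exact/measurable_EFinP.
- by apply: filterS fg => x fg _ /=; rewrite fg.
Qed.

Lemma RintegralT_norm_le f C : 0 <= C -> measurable_fun setT f ->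
  {ae P, forall x, `|f x| <= C} -> `|\int[P]_x f x|%R <= C.
Proof.
move=> C0 mf fC; have bf : ae_bounded f by split => //; exists C.
have fi := ae_bounded_integrable _ bf.
apply: (le_trans (le_normr_Rintegral measurableT fi)).
rewrite -[leRHS]RintegralT_cst; apply: fine_le.
- apply: integrable_fin_num => //.
  apply: (ae_bounded_integrable (fun x => `|f x|)).
  split; first exact: measurableT_comp.
  by exists C; apply: filterS fC => x; rewrite normr_id.
- by apply: integrable_fin_num => //; apply: ae_bounded_integrable; exact: ae_bounded_cst.
apply: ae_ge0_le_integral => //.
- by apply/measurable_EFinP; exact: measurableT_comp.
- by apply: filterS fC => x fC _ /=; rewrite lee_fin.
Qed.

End ae_bounded.

(** * Compactly supported planar measures *)

Section planar_measures.
Context {R : realType}.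
Implicit Types (P : probability (R * R)%type R) (mu : {measure set (R * R) -> \bar R}).

Lemma Pcstar_probability mu : Pcstar mu ->
  exists P : probability (R * R)%type R, mu = P :> {measure set (R * R) -> \bar R}.
Proof.
case=> mu1 _ _.
(* The Dirac mass is only the fallback of [mnormalize]; for total mass one the normalization changes
   nothing. *)
exists (mnormalize mu (@dirac _ (R * R)%type (0, 0) R)).
apply: eq_measure; apply/funext => A; rewrite /= /mnormalize.
rewrite (_ : mu setT = 1%E)//.
by rewrite onee_eq0/= invr1 mule1.
Qed.

Lemma measurable_ball2 (x : R * R) r : measurable (ball x r).
Proof.
have -> : ball x r = ball x.1 r `*` ball x.2 r by [].
by apply: measurableX; exact: measurable_ball.
Qed.

Lemma measurable_dotp th : measurable_fun setT (fun x : R * R => dotp x th).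
Proof.
by apply: measurable_funD; apply: measurable_funM.
Qed.

(* Every point outside the support lies in one of countably many null balls
   with rational centre and radius 1/(n+1). *)
Lemma negligible_setC_supp mu : mu.-negligible (~` supp mu).
Proof.
pose B (k : rat * rat * nat) := ball (ratr k.1.1 : R, ratr k.1.2 : R) (k.2.+1%:R^-1 : R).
pose F n := if unpickle n is Some k then
  if mu (B k) == 0%E then B k else set0 else set0.
apply: (@negligibleS _ _ _ _ (\bigcup_n F n)); last first.
  apply: negligible_bigcup => n; rewrite /F.
  case: unpickle => [k|]; last exact: negligible_set0.
  case: eqP => [Bk0|_]; last exact: negligible_set0.
  by apply/negligibleP => //; exact: measurable_ball2.
move=> x /= /existsNP[r /not_implyP[r0 /negP]].
rewrite -leNgt => xr.
(* The factor two is for the triangle inequality: a ball of radius [e] whose centre is within [e] of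
   [x] stays within [2 * e < r] of [x]. *)
have [n rn] : exists n, n.+1%:R^-1 < r / 2.
  have /ltr_add_invr[n] : 0 < r / 2 by rewrite divr_gt0.
  by rewrite add0r => ?; exists n.
pose e : R := n.+1%:R^-1.
have e0 : 0 < e by rewrite invr_gt0.
have x1e : x.1 - e < x.1 + e by lra.
have [p] := rat_in_itvoo x1e.
rewrite in_itv/= => /andP[p1 p2].
have x2e : x.2 - e < x.2 + e by lra.
have [q] := rat_in_itvoo x2e.
rewrite in_itv/= => /andP[q1 q2].
have Bx : B (p, q, n) `<=` ball x r.
  move=> y [/=]; rewrite /ball/= -/e !ltr_norml => /andP[? ?] /andP[? ?].
  by split; rewrite /ball/= ltr_norml; apply/andP; split;
    move: rn; rewrite -/e => rn; lra.
exists (pickle (p, q, n)); [exact: I|rewrite /F pickleK].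
have -> : mu (B (p, q, n)) == 0%E.
  rewrite eq_le measure_ge0 andbT (le_trans _ xr)//.
  by apply: le_measure; rewrite ?inE//; exact: measurable_ball2.
by split; rewrite /ball/= ltr_norml -/e; apply/andP; split; lra.
Qed.

Lemma Pcstar_bounded mu : Pcstar mu ->
  exists2 M : R, 0 <= M & {ae mu, forall x, `|x.1| <= M /\ `|x.2| <= M}.
Proof.
case=> _ /compact_bounded[M [_ Mbd]] _.
exists (`|M| + 1); first by rewrite addr_ge0.
apply: negligibleS (negligible_setC_supp mu) => x /= + sx; apply.
have := Mbd (`|M| + 1) _ x sx; rewrite (le_lt_trans (ler_norm M)) ?ltrDl//.
by move=> /(_ isT) /=; rewrite prod_normE/= ge_max => /andP.
Qed.

(** If almost all mass lay on the line, a support point off it would have a small ball missing the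
    line, hence null, against the definition of the support. *)
Lemma Pcstar_not_ae_line mu (u v m : R) : Pcstar mu -> (u, v) != (0, 0) ->
  ~ {ae mu, forall x, dotp x (u, v) = m}.
Proof.
move=> [_ _ noline] uv0 aem; apply: noline; exists u, v, m; split => // x sx /=.
apply/eqP/negPn/negP => xm.
pose e := `|u * x.1 + v * x.2 - m|.
have e0 : 0 < e by rewrite normr_gt0 subr_eq0.
(* [k] bounds the Lipschitz constant of the linear form for the max norm; the added one makes it
   positive. *)
pose k := `|u| + `|v| + 1.
have k0 : 0 < k by rewrite ltr_pwDr// addr_ge0.
have := sx (e / k); rewrite divr_gt0// => /(_ isT); apply/negP; rewrite -leNgt.
rewrite (measure_negligible (measurable_ball2 x (e / k)))//.
apply: negligibleS aem => y [/= y1 y2].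
rewrite /dotp/= => ym; move: y1 y2; rewrite /ball/= => y1 y2.
have : e < k * (e / k).
  have eE : e = `|u * (x.1 - y.1) + v * (x.2 - y.2)|.
    by rewrite /e -ym; congr `|_|; ring.
  rewrite [ltLHS]eE (le_lt_trans (ler_normD _ _))// !normrM.
  have ek : 0 < e / k by rewrite divr_gt0.
  move: (e / k) ek y1 y2 => d d0 y1 y2.
  rewrite /k !mulrDl mul1r -[ltLHS]addr0; apply: ler_ltD => //.
  by apply: lerD; rewrite ler_wpM2l// ltW.
by rewrite mulrCA divff ?mulr1 ?ltxx// gt_eqF.
Qed.

End planar_measures.

(** * Variance of the projections *)

Section variance.
Context {R : realType} (P : probability (R * R)%type R).
Hypothesis PP : Pcstar P.

Lemma ae_bounded_fst : ae_bounded P (fun x : R * R => x.1).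
Proof.
have [M _ PM] := Pcstar_bounded _ PP; split; first exact: measurable_fst.
by exists M; apply: filterS PM => x [].
Qed.

Lemma ae_bounded_snd : ae_bounded P (fun x : R * R => x.2).
Proof.
have [M _ PM] := Pcstar_bounded _ PP; split; first exact: measurable_snd.
by exists M; apply: filterS PM => x [].
Qed.

Let Q u v m : R := (\int[P]_x (dotp x (u, v) - m) ^+ 2)%R.

Let bounded_sqr u v m : ae_bounded P (fun x => (dotp x (u, v) - m) ^+ 2).
Proof.
apply: ae_boundedM; apply: ae_boundedD; try exact: ae_bounded_cst;
by apply: ae_boundedD; apply: ae_boundedM; try exact: ae_bounded_cst;
  [exact: ae_bounded_fst|exact: ae_bounded_snd].
Qed.

(** A vanishing integral of the square would put almost all mass on the line [dotp x (u, v) = m]. *)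
Let Q_gt0 u v m : (u, v) != (0, 0) -> 0 < Q u v m.
Proof.
move=> uv0; rewrite lt_neqAle Rintegral_ge0 ?andbT; last by move=> x _; exact: sqr_ge0.
apply/negP => /eqP /esym Q0.
apply: (Pcstar_not_ae_line _ _ _ m PP uv0).
have bs := bounded_sqr u v m.
have Q0' : (\int[P]_x `|((dotp x (u, v) - m) ^+ 2)%:E| = 0)%E.
  rewrite -[RHS]/(0%:E) -Q0 /Q /Rintegral fineK; last first.
    by apply: integrable_fin_num => //; exact: ae_bounded_integrable.
  by apply: eq_integral => x _; rewrite gee0_abs// lee_fin sqr_ge0.
move: Q0' => /ae_eq_integral_abs -/(_ measurableT).
have /[swap]/[apply] : measurable_fun setT (EFin \o (fun x : R * R => (dotp x (u, v) - m) ^+ 2)).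
  by apply/measurable_EFinP; case: bs.
apply: filterS => x /(_ I) /eqP; rewrite eqe sqrf_eq0 subr_eq0 => /eqP //.
Qed.

(** [Q] is the covariance form, with entries [a], [b], [c], plus the square of the distance from [m]
    to the mean. Positivity of [Q] at suitable vectors makes the form positive definite, and the
    bound holds for every centre [m]. *)
Lemma variance_lower_bound : exists2 lam : R, 0 < lam &
  forall th m, S1 th -> (lam%:E <= \int[P]_x ((dotp x th - m) ^+ 2)%:E)%E.
Proof.
have b1 := ae_bounded_fst; have b2 := ae_bounded_snd.
pose p : R := (\int[P]_x x.1)%R; pose q : R := (\int[P]_x x.2)%R.
pose a := (\int[P]_x (x.1 * x.1))%R - p ^+ 2.
pose b := (\int[P]_x (x.1 * x.2))%R - p * q.
pose c := (\int[P]_x (x.2 * x.2))%R - q ^+ 2.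
have QE u v m : Q u v m =
    (a * u ^+ 2 + 2 * b * u * v + c * v ^+ 2) + (p * u + q * v - m) ^+ 2.
  rewrite /Q; under eq_Rintegral.
    move=> x _.
    have -> : (dotp x (u, v) - m) ^+ 2 = u ^+ 2 * (x.1 * x.1) +
       (2 * u * v * (x.1 * x.2) + (v ^+ 2 * (x.2 * x.2) +
        (- 2 * m * u * x.1 + (- 2 * m * v * x.2 + m ^+ 2)))).
      by rewrite /dotp/=; ring.
    over.
  have B k f : ae_bounded P f -> ae_bounded P (fun x => k * f x).
    by move=> bf; apply: ae_boundedM => //; exact: ae_bounded_cst.
  have bc := ae_bounded_cst P (m ^+ 2).
  have B2 := B (- 2 * m * v) _ b2; have B1 := B (- 2 * m * u) _ b1.
  have b11 := ae_boundedM _ _ _ b1 b1.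
  have b12 := ae_boundedM _ _ _ b1 b2.
  have b22 := ae_boundedM _ _ _ b2 b2.
  have B11 := B (u ^+ 2) _ b11.
  have B12 := B (2 * u * v) _ b12.
  have B22 := B (v ^+ 2) _ b22.
  have D1 := ae_boundedD _ _ _ B2 bc.
  have D2 := ae_boundedD _ _ _ B1 D1.
  have D3 := ae_boundedD _ _ _ B22 D2.
  have D4 := ae_boundedD _ _ _ B12 D3.
  rewrite (RintegralTD _ _ _ B11 D4) (RintegralTD _ _ _ B12 D3).
  rewrite (RintegralTD _ _ _ B22 D2) (RintegralTD _ _ _ B1 D1).
  rewrite (RintegralTD _ _ _ B2 bc) RintegralT_cst.
  rewrite (RintegralTZ _ _ _ b11) (RintegralTZ _ _ _ b12) (RintegralTZ _ _ _ b22).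
  rewrite (RintegralTZ _ _ _ b1) (RintegralTZ _ _ _ b2) -/p -/q /a /b /c.
  by ring.
have a0 : 0 < a.
  have := @Q_gt0 1 0 p; rewrite xpair_eqE oner_eq0/= => /(_ isT).
  by rewrite QE; congr (_ < _); ring.
have c0 : 0 < c.
  have := @Q_gt0 0 1 q; rewrite xpair_eqE oner_eq0 andbF/= => /(_ isT).
  by rewrite QE; congr (_ < _); ring.
have d0 : 0 < a * c - b ^+ 2.
  (* At [(-b, a)], centred at its own mean, the form equals [a] times its determinant. *)
  have := @Q_gt0 (- b) a (- (p * b) + q * a).
  rewrite xpair_eqE (gt_eqF a0) andbF => /(_ isT); rewrite QE.
  rewrite (_ : _ + _ = a * (a * c - b ^+ 2)); last by ring.
  by rewrite pmulr_rgt0.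
have ac0 : 0 < a + c := addr_gt0 a0 c0.
(* Determinant over trace is a lower bound for the smaller eigenvalue. *)
exists ((a * c - b ^+ 2) / (a + c)); first exact: divr_gt0.
move=> [u v] m; rewrite /S1/= => uv1.
have bs := bounded_sqr u v m.
rewrite -[leRHS]fineK; last first.
  by apply: integrable_fin_num => //; exact: (ae_bounded_integrable _ _ bs).
rewrite -[fine _]/(Q u v m) lee_fin QE.
rewrite (@le_trans _ _ (a * u ^+ 2 + 2 * b * u * v + c * v ^+ 2))//; last first.
  by rewrite lerDl sqr_ge0.
rewrite (ler_pdivrMr _ _ ac0) -subr_ge0.
(* Cayley-Hamilton: trace times the form minus the determinant is the squared norm of the covariance
   matrix applied to the unit vector [(u, v)]. *)
have -> : (a * u ^+ 2 + 2 * b * u * v + c * v ^+ 2) * (a + c) - (a * c - b ^+ 2) =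
    (a * u + b * v) ^+ 2 + (b * u + c * v) ^+ 2.
  have -> : a * c - b ^+ 2 = (a * c - b ^+ 2) * (u ^+ 2 + v ^+ 2) by rewrite uv1 mulr1.
  by ring.
by rewrite addr_ge0// sqr_ge0.
Qed.

End variance.

(** * The normalized R-CDT *)

Section radon_cdt.
Context {R : realType} (rho : probability R R).
Hypothesis rho0 : forall x, rho [set x] = 0%E.
Implicit Types (P : probability (R * R)%type R) (th : R * R).

Lemma dotp_bound (x th : R * R) (M : R) : 0 <= M -> S1 th ->
  `|x.1| <= M -> `|x.2| <= M -> `|dotp x th| <= 2 * M.
Proof.
move=> M0 th1 x1 x2.
have thle (u v : R) : u ^+ 2 + v ^+ 2 = 1 -> `|u| <= 1.
  move=> uv1; rewrite -(@ler_pXn2r _ 2)// ?nnegrE//.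
  by rewrite expr1n real_normK ?num_real// -uv1 lerDl sqr_ge0.
rewrite (le_trans (ler_normD _ _))// !normrM mulr2n mulrDl !mul1r.
rewrite lerD// -[leRHS]mulr1 ler_pM//; first exact: thle th1.
by apply: thle; rewrite addrC; exact: th1.
Qed.

(** The bound [M] is chosen before the direction, so one bracket [[-M, M]] serves all the
    projections. *)
Lemma Rtheta_probability P : Pcstar P -> exists2 M : R, 0 <= M &
  forall th, S1 th -> exists nu : probability R R,
  [/\ Rtheta P th = nu :> (set R -> \bar R),
      forall s, s < - M -> Defs.cdf nu s = 0,
      Defs.cdf nu M = 1 &
      forall f : R -> \bar R, measurable_fun setT f -> (forall x, 0 <= f x)%E ->
        (\int[nu]_x f x = \int[P]_x f (dotp x th))%E].
Proof.
move=> PP; have [M M0 PM] := Pcstar_bounded P PP.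
exists (2 * M) => [|th th1]; first by rewrite mulr_ge0.
pose X : {mfun (R * R)%type >-> R} := mfun_Sub (mem_set (measurable_dotp th)).
exists (distribution P X).
have aeM : {ae P, forall x, `|X x| <= 2 * M}.
  by apply: filterS PM => x [x1 x2]; exact: dotp_bound.
have null (A : set R) : measurable A -> (forall x : R, `|x| <= 2 * M -> ~ A x) ->
    distribution P X A = 0%E.
  move=> mA A0; have mXA : measurable (X @^-1` A) by exact: measurable_funPTI.
  apply: (measure_negligible mXA).
  by apply: negligibleS aeM => x /= Ax /A0.
split => //.
- move=> s sM; rewrite /Defs.cdf [X in fine X]null// => x; rewrite ler_norml => /andP[Mx _] /=.
  by rewrite in_itv/= leNgt (lt_le_trans sM).
- have := EFin_ccdf (distribution P X) (2 * M).
  rewrite [RHS]null//; first by case=> /eqP; rewrite subr_eq0 => /eqP.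
  move=> x; rewrite ler_norml => /andP[_ xM] /=.
  by rewrite in_itv/= andbT ltNge xM.
- by move=> f mf f0; rewrite ge0_integral_distribution.
Qed.

(** Both constants are uniform over the circle, which is what makes the supremum over directions
    finite. *)
Lemma CDT_Rtheta P : Pcstar P -> exists M lam : R, [/\ 0 <= M, 0 < lam &
  forall th, S1 th -> let g := CDT rho (Rtheta P th) in
  [/\ measurable_fun setT g,
      forall t, `|g t| <= M,
      forall s t, Defs.cdf rho t < 1 -> s <= t -> g s <= g t,
      forall t, 1 <= Defs.cdf rho t -> g t = 0 &
      lam <= std rho g /\
      forall u, 0 <= u -> u < 1 -> has_inf [set s | u < Defs.cdf (Rtheta P th) s]]].
Proof.
move=> PP; have [M M0 PM] := Rtheta_probability P PP.
have [lam lam0 Plam] := variance_lower_bound P PP.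
exists M, (Num.sqrt lam); split => //; first by rewrite sqrtr_gt0.
move=> th th1 g; have [nu [nuE nuM nuM1 nuint]] := PM th th1.
have gE : g = CDT rho nu by rewrite /g nuE.
have mg : measurable_fun setT g by rewrite gE; exact: measurable_CDT nuM nuM1 rho.
have gM t : `|g t| <= M.
  rewrite gE; have [t1|t1] := ltP (Defs.cdf rho t) 1.
    by rewrite ler_norml; exact: CDT_bounds.
  by rewrite CDT_cdf_ge1// normr0.
split => //.
- by move=> s t t1 st; rewrite gE; exact: CDT_nd nuM nuM1 rho _ _ t1 st.
- by move=> t t1; rewrite gE; exact: CDT_cdf_ge1.
split.
- rewrite /std ler_sqrt; last first.
    by apply: fine_ge0; apply: integral_ge0 => x _; rewrite lee_fin sqr_ge0.
  set m := mean rho g.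
  have fin : (\int[rho]_x (`|g x - m| ^+ 2)%:E)%E \is a fin_num.
    apply: integrable_fin_num => //.
    apply: (ae_bounded_integrable rho (fun x => `|g x - m| ^+ 2)).
    under [X in ae_bounded _ X]eq_fun do rewrite real_normK ?num_real//.
    have bg : ae_bounded rho (fun x => g x - m).
      apply: ae_boundedD; last exact: ae_bounded_cst.
      by split => //; exists M; apply: nearW.
    exact: ae_boundedM.
  rewrite -lee_fin fineK//.
  under eq_integral do rewrite real_normK ?num_real//.
  pose f z : \bar R := ((z - m) ^+ 2)%:E.
  have mf : measurable_fun setT f.
    by apply/measurable_EFinP; apply: measurable_funX; exact: measurable_funB.
  have f0 x : (0 <= f x)%E by rewrite lee_fin sqr_ge0.
  (* The variance moves from [rho] to the projected measure, then to the plane, where the covariance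
     bound applies with centre [m]. *)
  rewrite gE (ge0_integral_CDT nu _ _ nuM nuM1 rho rho0 _ mf f0) nuint//.
  exact: Plam.
- move=> u u0 u1; rewrite nuE; split; first by exists M; rewrite /= nuM1.
  exists (- M) => s /= us; rewrite leNgt; apply/negP => /nuM s0.
  by move: us; rewrite s0 ltNge u0.
Qed.

Lemma S1_neq0 : @S1 R !=set0.
Proof. by exists (1, 0); rewrite /S1/= expr1n expr0n addr0. Qed.

Lemma mean_norm_le (g : R -> R) (M : R) : 0 <= M -> measurable_fun setT g ->
  (forall t, `|g t| <= M) -> `|mean rho g| <= M.
Proof. by move=> M0 mg gM; apply: RintegralT_norm_le => //; apply: nearW. Qed.

Lemma Ntheta_bounded P : Pcstar P -> exists C : R,
  forall th t, S1 th -> `|Ntheta rho P th t| <= C.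
Proof.
move=> PP; have [M [lam [M0 lam0 H]]] := CDT_Rtheta P PP.
exists ((M + M) / lam) => th t th1.
have [mg gM _ _ [sl _]] := H th th1.
rewrite /Ntheta normrM normfV ler_pM//.
  by rewrite (le_trans (ler_normB _ _))// lerD// mean_norm_le.
have s0 := lt_le_trans lam0 sl.
by rewrite (gtr0_norm s0) lef_pV2 ?posrE.
Qed.

Lemma Nm_bounded P : Pcstar P -> exists C : R, forall t, `|Nm rho P t| <= C.
Proof.
move=> PP; have [C HC] := Ntheta_bounded P PP.
have [th0 th01] := S1_neq0.
exists C => t; rewrite ler_norml; apply/andP; split.
  apply: (@le_trans _ _ (Ntheta rho P th0 t)).
    by have := HC th0 t th01; rewrite ler_norml => /andP[].
  apply: ub_le_sup; last by exists th0.
  by exists C => _ [th th1 <-]; apply: le_trans (ler_norm _) (HC _ _ th1).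
apply: ge_sup; first by exists (Ntheta rho P th0 t), th0.
by move=> _ [th th1 <-]; apply: le_trans (ler_norm _) (HC _ _ th1).
Qed.

Lemma measurable_Nm P : Pcstar P -> measurable_fun setT (Nm rho P).
Proof.
move=> PP; have [C HC] := Ntheta_bounded P PP.
have [th0 th01] := S1_neq0.
have [M [lam [M0 lam0 H]]] := CDT_Rtheta P PP.
(* The constant is the supremum obtained when every CDT takes its junk value [0]. *)
apply: (@measurable_split_cdf_lt1 _ rho _
  (sup [set (0 - mean rho (CDT rho (Rtheta P th))) / std rho (CDT rho (Rtheta P th)) | th in S1])).
- move=> s t t1 st; apply: ge_sup; first by exists (Ntheta rho P th0 s), th0.
  move=> _ [th th1 <-]; apply: (@le_trans _ _ (Ntheta rho P th t)).
    have [_ _ gnd _ [sl _]] := H th th1.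
    rewrite /Ntheta ler_pM2r ?lerB ?gnd// invr_gt0.
    exact: lt_le_trans lam0 sl.
  apply: ub_le_sup; last by exists th.
  by exists C => _ [th' th1' <-]; apply: le_trans (ler_norm _) (HC _ _ th1').
- move=> t t1; congr sup; apply: eq_imagel => th th1.
  by have [_ _ _ g0 _] := H th th1; rewrite /Ntheta g0.
Qed.

End radon_cdt.

(** * Affine images *)

Section affine_maps.
Context {R : realType}.
Implicit Types (A : 'M[R]_2) (x y th : R * R) (mu : {measure set (R * R) -> \bar R}).

Lemma det_mx2 A :
  \det A = A ord0 ord0 * A ord_max ord_max - A ord0 ord_max * A ord_max ord0.
Proof.
rewrite (expand_det_row _ ord0) !big_ord_recl big_ord0 /cofactor !det_mx11 !mxE/=.
rewrite addr0 expr0 expr1 mul1r mulN1r mulrN.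
by congr (_ * A _ _ - A _ _ * A _ _); apply/val_inj.
Qed.

Lemma affine_cancel A y : \det A != 0 -> exists (B : 'M[R]_2) z,
  [/\ \det B != 0, cancel (affine A y) (affine B z) &
      cancel (affine B z) (affine A y)].
Proof.
rewrite det_mx2; set a := A ord0 ord0; set b := A ord0 ord_max.
set c := A ord_max ord0; set d := A ord_max ord_max => D0.
pose D := a * d - b * c.
(* The inverse matrix as adjugate over determinant; the translation chosen next is [-B y]. *)
pose B : 'M[R]_2 := \matrix_(i < 2, j < 2)
  (if i == ord0 then if j == ord0 then d / D else - b / D
   else if j == ord0 then - c / D else a / D).
exists B, (- (d * y.1 - b * y.2) / D, - (a * y.2 - c * y.1) / D); split.
- rewrite det_mx2 !mxE/= (_ : _ - _ = D^-1) ?invr_eq0// /D; by field.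
- by move=> [u v]; rewrite /affine !mxE/= -/a -/b -/c -/d /D; congr pair; field.
- by move=> [u v]; rewrite /affine !mxE/= -/a -/b -/c -/d /D; congr pair; field.
Qed.

Lemma measurable_affine A y : measurable_fun setT (affine A y).
Proof.
apply: measurable_fun_pair => /=;
by apply: measurable_funD => //; apply: measurable_funD => //; apply: measurable_funM.
Qed.

Lemma continuous_affine A y : continuous (affine A y).
Proof.
move=> x.
have C (a b c : R) : (fun z : R * R => a * z.1 + b * z.2 + c) @ x -->
    a * x.1 + b * x.2 + c.
  apply: cvgD; last exact: cvg_cst.
  by apply: cvgD; apply: cvgM; [exact: cvg_cst|exact: cvg_fst|exact: cvg_cst|exact: cvg_snd].
exact: (cvg_pair (C _ _ _) (C _ _ _)).
Qed.

Lemma pushforward_affine_cancel (mu nu : {measure set (R * R) -> \bar R}) A B y z :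
  (nu : set (R * R) -> \bar R) = pushforward mu (affine A y) ->
  cancel (affine A y) (affine B z) ->
  (mu : set (R * R) -> \bar R) = pushforward nu (affine B z).
Proof.
move=> -> AK; apply/funext => X.
by rewrite /pushforward -comp_preimage (_ : _ \o _ = id) ?preimage_id//;
  apply/funext => x /=; rewrite AK.
Qed.

Lemma affine_class_sym mu nu : affine_class mu nu -> affine_class nu mu.
Proof.
move=> [A [y [A0 nuE]]]; have [B [z [B0 AK BK]]] := affine_cancel A y A0.
by exists B, z; split => //; exact: pushforward_affine_cancel nuE AK.
Qed.

(** By continuity, the preimage of a ball around the image contains a ball around [x]. The inverse
    map later supplies the reverse inclusion of supports. *)
Lemma supp_pushforward_affine mu (nu : {measure set (R * R) -> \bar R}) A y x :
  (nu : set (R * R) -> \bar R) = pushforward mu (affine A y) ->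
  supp mu x -> supp nu (affine A y x).
Proof.
move=> nuE sx r r0; rewrite nuE /pushforward.
have /continuous_affine : nbhs (affine A y x) (ball (affine A y x) r).
  exact: nbhsx_ballx.
move=> /nbhs_ballP[e e0 xe]; apply: lt_le_trans (sx e e0) _.
apply: le_measure; rewrite ?inE//; first exact: measurable_ball2.
rewrite -[X in measurable X]setTI; apply: measurable_affine => //.
exact: measurable_ball2.
Qed.

Lemma affine_class_Pcstar mu : Pcstar mu -> affine_class mu `<=` Pcstar.
Proof.
move=> [mu1 cmu noline] nu [A [y [A0 nuE]]].
have [B [z [B0 AK BK]]] := affine_cancel A y A0.
have muE := pushforward_affine_cancel _ _ _ _ _ _ nuE AK.
have suppE : supp nu = [set affine A y x | x in supp mu].
  apply/seteqP; split => [x sx|_ [x sx <-]].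
    by exists (affine B z x) => //; exact: supp_pushforward_affine muE sx.
  exact: supp_pushforward_affine nuE sx.
split.
- by rewrite nuE /pushforward preimage_setT.
- rewrite suppE; apply: continuous_compact => //.
  by apply: continuous_subspaceT; exact: continuous_affine.
- move=> [u [v [w [uv0 sline]]]]; apply: noline.
  (* The line pulls back to one with normal [A^T (u, v)], nonzero because [A] is invertible. *)
  exists (u * A ord0 ord0 + v * A ord_max ord0),
    (u * A ord0 ord_max + v * A ord_max ord_max), (w - u * y.1 - v * y.2).
  split.
    apply: contra uv0; rewrite !xpair_eqE => /andP[/eqP e1 /eqP e2].
    move: A0; rewrite det_mx2.
    set a := A ord0 ord0 in e1 *; set b := A ord0 ord_max in e2 *.
    set c := A ord_max ord0 in e1 *; set d := A ord_max ord_max in e2 * => D0.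
    have uD : u * (a * d - b * c) = 0.
      have -> : u * (a * d - b * c) = d * (u * a + v * c) - c * (u * b + v * d) by ring.
      by rewrite e1 e2 !mulr0 subr0.
    have vD : v * (a * d - b * c) = 0.
      have -> : v * (a * d - b * c) = a * (u * b + v * d) - b * (u * a + v * c) by ring.
      by rewrite e1 e2 !mulr0 subr0.
    by move/eqP: uD; move/eqP: vD; rewrite !mulf_eq0 (negbTE D0) !orbF => -> ->.
  move=> x sx /=.
  have /sline /= : supp nu (affine A y x) by rewrite suppE; exists x.
  by move=> <-; ring.
Qed.

End affine_maps.

(** * Affine invariance of the max-normalized R-CDT *)

Section affine_invariance.
Context {R : realType} (rho : probability R R).
Hypothesis rho0 : forall x, rho [set x] = 0%E.
Implicit Types (P Q : probability (R * R)%type R) (th : R * R).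

Lemma dotp_affine (A : 'M[R]_2) (y th : R * R) : \det A != 0 -> S1 th ->
  exists k b th', [/\ 0 < k, S1 th' &
    forall x, dotp (affine A y x) th = k * dotp x th' + b].
Proof.
rewrite det_mx2 => D0 th1.
(* [(u, v)] is [A^T th]; its norm will be [k], its direction [th'], and [b] will be [dotp y th]. *)
pose u := A ord0 ord0 * th.1 + A ord_max ord0 * th.2.
pose v := A ord0 ord_max * th.1 + A ord_max ord_max * th.2.
have uv0 : 0 < u ^+ 2 + v ^+ 2.
  rewrite lt_neqAle addr_ge0 ?sqr_ge0// andbT eq_sym paddr_eq0 ?sqr_ge0//.
  rewrite !sqrf_eq0; apply/negP => /andP[/eqP u0 /eqP v0].
  set D := _ - _ in D0.
  have t1 : D * th.1 = 0.
    have -> : D * th.1 = A ord_max ord_max * u - A ord_max ord0 * v.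
      by rewrite /D /u /v; ring.
    by rewrite u0 v0 !mulr0 subr0.
  have t2 : D * th.2 = 0.
    have -> : D * th.2 = A ord0 ord0 * v - A ord0 ord_max * u.
      by rewrite /D /u /v; ring.
    by rewrite u0 v0 !mulr0 subr0.
  move/eqP: t1; rewrite mulf_eq0 (negbTE D0)/= => /eqP t1.
  move/eqP: t2; rewrite mulf_eq0 (negbTE D0)/= => /eqP t2.
  by move: th1 => /eqP; rewrite /S1/= t1 t2 expr0n addr0 eq_sym oner_eq0.
pose k := Num.sqrt (u ^+ 2 + v ^+ 2).
have k0 : 0 < k by rewrite sqrtr_gt0.
have k2 : k ^+ 2 = u ^+ 2 + v ^+ 2 by rewrite sqr_sqrtr// ltW.
have kN0 : k != 0 by rewrite gt_eqF.
exists k, (dotp y th), (u / k, v / k); split => //.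
  by rewrite /S1/= !expr_div_n -mulrDl -k2 divff// expf_neq0.
by move=> x; rewrite /dotp /affine/= /u /v; field.
Qed.

(** The increasing map [s |-> k * s + b] carries the superlevel set of [F] onto that of [G];
    [has_inf] makes the infimum a genuine one. *)
Lemma ginv_affine (F G : R -> R) (k b u : R) : 0 < k ->
  (forall s, G s = F ((s - b) / k)) -> has_inf [set s | u < F s] ->
  ginv G u = k * ginv F u + b.
Proof.
move=> k0 GE infF; have kN0 : k != 0 by rewrite gt_eqF.
have [[s0 Fs0] lbF] := infF.
have GF s : u < F s -> u < G (k * s + b).
  by rewrite GE addrK mulrC mulKf.
have lbG : lbound [set s | u < G s] (k * ginv F u + b).
  move=> s /=; rewrite GE => us; rewrite -lerBrDr mulrC -ler_pdivlMr//.
  exact: ge_inf.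
apply/eqP; rewrite eq_le; apply/andP; split; last first.
  by apply: lb_le_inf => //; exists (k * s0 + b); exact: GF.
rewrite -lerBlDr mulrC -ler_pdivrMr//; apply: lb_le_inf; first by exists s0.
move=> s us; rewrite ler_pdivrMr// lerBlDr mulrC; apply: ge_inf.
  by exists (k * ginv F u + b).
exact: GF.
Qed.

Lemma ae_cdf_lt1 : {ae rho, forall t, Defs.cdf rho t < 1}.
Proof.
apply: (@negligibleS _ _ _ _ [set t | 1 <= Defs.cdf rho t]).
  by move=> t /= /negP; rewrite -leNgt.
by apply/negligibleP; [exact: measurable_cdf_ge|exact: atomless_cdf_ge1].
Qed.

(* The restriction [F_rho t < 1] is needed: the junk value [0] of the CDT elsewhere
   is not compatible with translations. *)
Lemma Ntheta_affine P Q th : Pcstar P -> Pcstar Q -> affine_class P Q -> S1 th ->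
  exists2 th', S1 th' & forall t, Defs.cdf rho t < 1 ->
    Ntheta rho Q th t = Ntheta rho P th' t.
Proof.
move=> PP QP [A [y [A0 QE]]] th1.
have [k [b [th' [k0 th'1 dE]]]] := dotp_affine A y th A0 th1.
exists th'; first exact: th'1.
move=> t0 t01.
have [M [lam [M0 lam0 HP]]] := CDT_Rtheta rho rho0 P PP.
have [M' [lam' [M'0 lam'0 HQ]]] := CDT_Rtheta rho rho0 Q QP.
have [mg gM _ _ [sg infg]] := HP th' th'1.
have [mh hM _ _ [sh _]] := HQ th th1.
rewrite /Ntheta.
set g := CDT rho (Rtheta P th') in mg gM sg *.
set h := CDT rho (Rtheta Q th) in mh hM sh *.
have hE t : Defs.cdf rho t < 1 -> h t = k * g t + b.
  move=> t1; apply: ginv_affine => //; last by apply: infg => //; exact: dcdf_ge0.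
  move=> s; rewrite /Defs.cdf /Rtheta QE /pushforward; congr (fine (P _)).
  apply/seteqP; split => x /=; rewrite !in_itv/= dE.
    by rewrite ler_pdivlMr// lerBrDr mulrC.
  by rewrite ler_pdivlMr// lerBrDr mulrC.
have bg : ae_bounded rho g by split => //; exists M; exact: nearW.
have bk : ae_bounded rho (fun x => k * g x).
  by apply: ae_boundedM => //; exact: ae_bounded_cst.
have meanE : mean rho h = k * mean rho g + b.
  rewrite -[mean rho h]/(\int[rho]_x h x)%R -[mean rho g]/(\int[rho]_x g x)%R.
  rewrite (ae_eq_RintegralT rho h (fun x => k * g x + b))//.
  - by rewrite RintegralTD ?RintegralTZ ?RintegralT_cst//; exact: ae_bounded_cst.
  - by apply: measurable_funD => //; exact: (proj1 bk).
  - by apply: filterS ae_cdf_lt1 => x; exact: hE.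
have stdE : std rho h = k * std rho g.
  have bs : ae_bounded rho (fun x => `|g x - mean rho g| ^+ 2).
    split; last first.
      exists ((M + `|mean rho g|) ^+ 2); apply: nearW => x.
      rewrite ger0_norm ?sqr_ge0// ler_pXn2r ?nnegrE// ?addr_ge0//.
      by rewrite (le_trans (ler_normB _ _))// lerD2r.
    apply: measurable_funX; apply: measurableT_comp => //.
    exact: measurable_funB.
  rewrite -[std rho h]/(Num.sqrt (\int[rho]_x `|h x - mean rho h| ^+ 2)%R).
  rewrite -[std rho g]/(Num.sqrt (\int[rho]_x `|g x - mean rho g| ^+ 2)%R).
  rewrite (ae_eq_RintegralT rho _ (fun x => k ^+ 2 * `|g x - mean rho g| ^+ 2)).
  - by rewrite RintegralTZ// sqrtrM ?sqr_ge0// sqrtr_sqr gtr0_norm.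
  - apply: measurable_funX; apply: measurableT_comp => //.
    exact: measurable_funB.
  - by apply: measurable_funM => //; exact: (proj1 bs).
  - apply: filterS ae_cdf_lt1 => x x1; rewrite hE// meanE.
    rewrite (_ : _ - _ = k * (g x - mean rho g)); last by ring.
    by rewrite normrM exprMn gtr0_norm.
rewrite (hE _ t01) meanE stdE; clearbody g.
have sN0 : std rho g != 0 := lt0r_neq0 (lt_le_trans lam0 sg).
have kN0 : k != 0 := lt0r_neq0 k0.
move: (std rho g) (mean rho g) (g t0) sN0 => s m z sN0.
by field; rewrite sN0 kN0.
Qed.

(** The two suprema range over the same set of values: one inclusion comes from the affine map, the
    other from its inverse. *)
Lemma Nm_affine_lt1 P Q t : Pcstar P -> affine_class P Q ->
  Defs.cdf rho t < 1 -> Nm rho Q t = Nm rho P t.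
Proof.
move=> PP PQ t1; have QP := affine_class_Pcstar P PP Q PQ.
apply: (congr1 sup); apply/seteqP; split => _ [th th1 <-].
  have [th' th'1 NE] := Ntheta_affine P Q th PP QP PQ th1.
  by exists th'; [exact: th'1|rewrite (NE t t1)].
have [th' th'1 NE] := Ntheta_affine Q P th QP PP (affine_class_sym P Q PQ) th1.
by exists th'; [exact: th'1|rewrite (NE t t1)].
Qed.

Lemma Nm_affine P Q : Pcstar P -> affine_class P Q ->
  {ae rho, forall t, Nm rho Q t = Nm rho P t}.
Proof.
by move=> PP PQ; apply: filterS ae_cdf_lt1 => t; exact: Nm_affine_lt1.
Qed.

End affine_invariance.

(** * Separation *)

Section linf.
Context {R : realType} (rho : probability R R).
Implicit Types f g : R -> R.

(** The norm at exponent infinity is an essential supremum only on a space of positive mass, hence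
    the appeal to total mass one. *)
Let NE f : ('N[rho]_+oo[EFin \o f] = ess_sup rho (abse \o (EFin \o f)))%E.
Proof. by rewrite unlock /= ifT// [X in (_ < X)%E]probability_setT lte01. Qed.

Lemma Linf_of_bounded f (C : R) : measurable_fun setT f ->
  (forall t, `|f t| <= C) -> Linf rho f.
Proof.
move=> mf fC; split => //; rewrite /finite_norm NE.
apply: (@le_lt_trans _ _ C%:E); last exact: ltry.
by apply/ess_supP; apply: nearW => t /=; rewrite lee_fin.
Qed.

Lemma Linf_ae_le f : Linf rho f ->
  {ae rho, forall t, `|f t| <= fine 'N[rho]_+oo[EFin \o f]%E}.
Proof.
move=> [mf fin].
have finN : 'N[rho]_+oo[EFin \o f]%E \is a fin_num.
  by rewrite ge0_fin_numE ?Lnorm_ge0.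
have : {ae rho, forall t, ((abse \o (EFin \o f)) t <= 'N[rho]_+oo[EFin \o f])%E}.
  by rewrite NE; exact: ess_sup_ge.
by apply: filterS => t; rewrite -[X in (_ <= X)%E]fineK//= lee_fin.
Qed.

Lemma Linf_ae_bounded f : Linf rho f -> ae_bounded rho f.
Proof.
move=> Lf; split; first by case: Lf.
by exists (fine 'N[rho]_+oo[EFin \o f]%E); exact: Linf_ae_le.
Qed.

Lemma cont_lin_functional_Rintegral h : ae_bounded rho h ->
  cont_lin_functional rho (fun f => \int[rho]_x (h x * f x))%R.
Proof.
move=> bh; split.
  move=> a f g /Linf_ae_bounded bf /Linf_ae_bounded bg.
  have bhf := ae_boundedM _ _ _ bh bf; have bhg := ae_boundedM _ _ _ bh bg.
  rewrite -RintegralTZ// -RintegralTD//; last first.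
    by apply: ae_boundedM => //; exact: ae_bounded_cst.
  by congr fine; apply: eq_integral => x _; congr EFin; ring.
have [mh [C hC]] := bh.
exists `|C| => f Lf; have [mf _] := Linf_ae_bounded _ Lf.
apply: RintegralT_norm_le.
- by rewrite mulr_ge0// fine_ge0// Lnorm_ge0.
- exact: measurable_funM.
- apply: filterS2 hC (Linf_ae_le _ Lf) => x hC fN.
  by rewrite normrM ler_pM// (le_trans hC)// ler_norm.
Qed.

End linf.

Theorem theorem9 (R : realType) (rho : probability R R)
  (mu0 nu0 : {measure set (R * R) -> \bar R}) :
  (forall x : R, rho [set x] = 0%E) ->
  Pcstar mu0 -> Pcstar nu0 ->
  ~ {ae rho, forall t, Nm rho mu0 t = Nm rho nu0 t} ->
  [/\ affine_class mu0 `<=` Pcstar,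
      affine_class nu0 `<=` Pcstar,
      (forall mu, affine_class mu0 mu \/ affine_class nu0 mu -> Linf rho (Nm rho mu))
    & lin_separable rho (Nm rho @` affine_class mu0) (Nm rho @` affine_class nu0)].
Proof.
move=> rho0 Pmu0 Pnu0 Nneq.
have LNm mu : Pcstar mu -> Linf rho (Nm rho mu).
  move=> Pmu; have [P PE] := Pcstar_probability mu Pmu; rewrite {}PE in Pmu *.
  have [C NC] := Nm_bounded rho rho0 P Pmu.
  by apply: Linf_of_bounded NC; exact: measurable_Nm.
have Naffine mu nu : Pcstar mu -> affine_class mu nu ->
    {ae rho, forall t, Nm rho nu t = Nm rho mu t}.
  move=> Pmu munu; have Pnu := affine_class_Pcstar mu Pmu nu munu.
  have [P PE] := Pcstar_probability mu Pmu.
  have [Q QE] := Pcstar_probability nu Pnu.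
  by rewrite PE QE in Pmu munu *; exact: Nm_affine.
split; [exact: affine_class_Pcstar|exact: affine_class_Pcstar| |].
  by move=> mu [] /affine_class_Pcstar Pmu; apply: LNm; exact: Pmu.
pose f0 := Nm rho mu0; pose g0 := Nm rho nu0.
have bf : ae_bounded rho f0 by apply: Linf_ae_bounded; exact: LNm.
have bg : ae_bounded rho g0 by apply: Linf_ae_bounded; exact: LNm.
pose h t := f0 t + - 1 * g0 t.
have bh : ae_bounded rho h.
  by apply: ae_boundedD => //; apply: ae_boundedM => //; exact: ae_bounded_cst.
pose l f : R := (\int[rho]_x (h x * f x))%R.
(* [l] is an integral, so it ignores the null set where invariance may fail and is constant on each
   class. *)
have lE mu nu : Pcstar mu -> affine_class mu nu -> l (Nm rho nu) = l (Nm rho mu).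
  move=> Pmu munu; have Pnu := affine_class_Pcstar mu Pmu nu munu.
  have [mf _] := Linf_ae_bounded _ _ (LNm _ Pmu).
  have [mg _] := Linf_ae_bounded _ _ (LNm _ Pnu).
  apply: ae_eq_RintegralT.
  - by apply: measurable_funM => //; case: bh.
  - by apply: measurable_funM => //; case: bh.
  - by apply: filterS (Naffine _ _ Pmu munu) => t ->.
have bhh := ae_boundedM _ _ _ bh bh.
have lfg : l f0 - l g0 = (\int[rho]_x (h x * h x))%R.
  have bhf := ae_boundedM _ _ _ bh bf; have bhg := ae_boundedM _ _ _ bh bg.
  rewrite -mulN1r /l -RintegralTZ// -RintegralTD//; last first.
    by apply: ae_boundedM => //; exact: ae_bounded_cst.
  by congr fine; apply: eq_integral => x _; congr EFin; rewrite /h; ring.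
have gap : 0 < l f0 - l g0.
  rewrite lfg lt_neqAle Rintegral_ge0 ?andbT; last first.
    by move=> x _; rewrite -expr2 sqr_ge0.
  (* A zero gap makes [h] vanish almost everywhere, so the two transforms would agree. *)
  apply/negP => /eqP /esym hh0; apply: Nneq.
  have : (\int[rho]_x `|(h x * h x)%:E| = 0)%E.
    rewrite -[RHS]/(0%:E) -hh0 /Rintegral fineK; last first.
      by apply: integrable_fin_num => //; exact: ae_bounded_integrable.
    by apply: eq_integral => x _; rewrite gee0_abs// lee_fin -expr2 sqr_ge0.
  have mhh : measurable_fun setT (EFin \o (fun x => h x * h x)).
    by apply/measurable_EFinP; case: bhh.
  move=> /(ae_eq_integral_abs rho measurableT mhh).
  apply: filterS => t /(_ I) /eqP; rewrite eqe mulf_eq0 orbb /h mulN1r subr_eq0.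
  by move=> /eqP.
have lcont : cont_lin_functional rho l by exact: cont_lin_functional_Rintegral.
have lf mu : affine_class mu0 mu -> l (Nm rho mu) = l f0 := lE _ _ Pmu0.
have lg mu : affine_class nu0 mu -> l (Nm rho mu) = l g0 := lE _ _ Pnu0.
(* The threshold is the midpoint of the two values taken by [l]. *)
exists l, ((l f0 + l g0) / 2); split; first exact: lcont.
clearbody l f0 g0.
split => _ [mu mumu <-]; [rewrite (lf _ mumu)|rewrite (lg _ mumu)]; lra.
Qed.
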